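(* Let $a,b>0$ be real numbers. Then $$D(2b,a,a)=D(2a,b,b),$$ where $D(d_0,d_1,d_2)$ denotes the Hausdorff dimension of the limit set of the group generated by the hyperbolic reflections in three non-nested geodesics of the hyperbolic plane whose pairwise hyperbolic distances are $d_0,d_1,d_2$.
   Context: Let $\mathbb{D}=\{z\in\mathbb{C}:|z|<1\}$ be the Poincaré unit disk with its hyperbolic metric and boundary $S^1=\partial\mathbb{D}$. Geodesics of $\mathbb{D}$ are intersections with $\mathbb{D}$ of Euclidean circles (or lines) meeting $S^1$ orthogonally. The hyperbolic reflection in a geodesic $g$ is the restriction to $\mathbb{D}$ of the Euclidean reflection (inversion) in the circle carrying $g$; it extends to $S^1$. Three geodesics $g_0,g_1,g_2$ are called non-nested if they are pairwise disjoint and none of them separates the other two (up to an isometry of $\mathbb{D}$: the closed Euclidean disks bounded by the circles carrying them are pairwise disjoint). Given $d_0,d_1,d_2>0$ there is, up to isometries of $\mathbb{D}$, a unique configuration of three non-nested geodesics $g_0,g_1,g_2$ whose three pairwise hyperbolic distances are $d_0,d_1,d_2$ (the three geodesics and the three common perpendicular segments, of lengths $d_0,d_1,d_2$, bound a right-angled hexagon). Let $\Gamma_{g_0,g_1,g_2}$ be the discrete group of isometries of $\mathbb{D}$ generated by the hyperbolic reflections in $g_0,g_1,g_2$. The limit set of $\Gamma=\Gamma_{g_0,g_1,g_2}$ is $\Lambda_\infty(\Gamma)=\overline{\Gamma\cdot p}\cap S^1$ for any $p\in\mathbb{D}$ (closure taken in $\mathbb{C}$; it does not depend on $p$). The function $D$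 is defined by $D(d_0,d_1,d_2):=\dim_H\Lambda_\infty(\Gamma_{g_0,g_1,g_2})$, where $\dim_H$ is Hausdorff dimension; this depends only on $d_0,d_1,d_2$ and not on the choice of the configuration or on the order of the distances. *)

(* Defs.v *)
From HB Require Import structures.
From mathcomp Require Import all_boot all_order all_algebra.
From mathcomp Require Import all_classical all_reals all_analysis.
From mathcomp Require Import complex.

Set Implicit Arguments.
Unset Strict Implicit.
Unset Printing Implicit Defensive.

Import Order.TTheory GRing.Theory Num.Theory.
Import numFieldNormedType.Exports.
Import Normc.

Local Open Scope classical_set_scope.
Local Open Scope ring_scope.

(** The norm `|z| of z : R[i] lives in R[i]; [normc z] is the same modulus with
    values in R, and [complex.Re] is the R-valued real part. *)

(** The topology of the plane, given by the norm of the field R[i]. *)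
HB.instance Definition _ (R : realType) := NormedModule.copy R[i] R[i]^o.

Section HausdorffDimension.
Variable R : realType.
Local Open Scope ereal_scope.

(** diam set0 = -oo, so empty sets are allowed in every cover. *)
Definition diam (A : set R[i]) : \bar R :=
  ereal_sup [set (normc (x - y))%:E | x in A & y in A].

(** (diam A)^s, with (diam set0)^s = 0 for all s (whereas 0 `^ 0 = 1, so that
    points have weight 1 for s = 0). *)
Definition diam_pow (s : R) (A : set R[i]) : \bar R :=
  if A == set0 then 0 else poweR (diam A) s.

Definition hausdorff_premeasure (s delta : R) (A : set R[i]) : \bar R :=
  ereal_inf [set \sum_(0 <= i <oo) diam_pow s (U i) |
    U in [set U : nat -> set R[i] |
      A `<=` \bigcup_i U i /\ forall i, diam (U i) <= delta%:E]].

Definition hausdorff_measure (s : R) (A : set R[i]) : \bar R :=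
  ereal_sup [set hausdorff_premeasure s delta A | delta in [set d : R | 0 < d]%R].

Definition hausdorff_dim (A : set R[i]) : \bar R :=
  ereal_inf [set s%:E | s in [set s : R | (0 <= s)%R /\ hausdorff_measure s A = 0]].

End HausdorffDimension.

Section HyperbolicDisk.
Variable R : realType.

Definition unit_disk : set R[i] := [set z | normc z < 1].
Definition unit_circle : set R[i] := [set z | normc z = 1].

(** The distance of the Poincare metric 2|dz|/(1 - |z|^2) of curvature -1:
    2 artanh t = ln ((1 + t)/(1 - t)), where t = |z - w| / |1 - z conj(w)|. *)
Definition hyp_dist (z w : R[i]) : R :=
  let t := normc (z - w) / normc (1 - z * conjc w) in
  ln ((1 + t) / (1 - t)).

(** [Circle c r] is {z | |z - c| = r}; [Line n k] is {z | <n, z> = k}, where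
    <n, z> = Re (conj(n) z) is the Euclidean inner product. *)
Inductive circline : Type :=
  | Circle of R[i] & R
  | Line of R[i] & R.

Definition nondegenerate (C : circline) : Prop :=
  match C with
  | Circle _ r => 0 < r
  | Line n _ => n != 0
  end.

Definition inner (z w : R[i]) : R := complex.Re (conjc z * w).

Definition carrier (C : circline) : set R[i] :=
  match C with
  | Circle c r => [set z | normc (z - c) = r]
  | Line n k => [set z | inner n z = k]
  end.

(** A normal vector of the curve at its point z. *)
Definition normal (C : circline) (z : R[i]) : R[i] :=
  match C with
  | Circle c _ => z - c
  | Line n _ => n
  end.

(** The normal vector of the unit circle at z is z itself. *)
Definition meets_unit_circle_orthogonally (C : circline) : Prop :=
  carrier C `&` unit_circle !=set0 /\
  forall z, (carrier C `&` unit_circle) z -> inner (normal C z) z = 0.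

(** Inversion in the circle c + r S^1 is z |-> c + r^2 / conj(z - c). As
    0^-1 = 0, it fixes c here, so it is an involution of the whole of C; the
    center of a circle orthogonal to the unit circle is never in the disk. *)
Definition reflection (C : circline) (z : R[i]) : R[i] :=
  match C with
  | Circle c r => c + (r ^+ 2)%:C%C / conjc (z - c)
  | Line n k => z - (2 * (inner n z - k) / inner n n)%:C%C * n
  end.

Record geodesic : Type := Geodesic {
  support : circline;
  support_nondegenerate : nondegenerate support;
  support_orthogonal : meets_unit_circle_orthogonally support
}.

Definition geodesic_set (g : geodesic) : set R[i] :=
  carrier (support g) `&` unit_disk.

Definition geodesic_reflection (g : geodesic) : R[i] -> R[i] :=
  reflection (support g).

Definition geodesic_dist (g h : geodesic) : R :=
  inf [set hyp_dist z w | z in geodesic_set g & w in geodesic_set h].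

Definition disjoint_geodesics (g h : geodesic) : Prop :=
  geodesic_set g `&` geodesic_set h = set0.

Definition separates (g h k : geodesic) : Prop :=
  forall z w, geodesic_set h z -> geodesic_set k w ->
    ~ connected_component (unit_disk `\` geodesic_set g) z w.

Definition non_nested (g0 g1 g2 : geodesic) : Prop :=
  [/\ disjoint_geodesics g0 g1, disjoint_geodesics g1 g2 &
      disjoint_geodesics g2 g0] /\
  [/\ ~ separates g0 g1 g2, ~ separates g1 g2 g0 & ~ separates g2 g0 g1].

Inductive generated_group (S : set (R[i] -> R[i])) : set (R[i] -> R[i]) :=
  | generated_mem f : S f -> generated_group S f
  | generated_id : generated_group S id
  | generated_comp f g : generated_group S f -> generated_group S g ->
      generated_group S (f \o g)
  | generated_inv f g : generated_group S f -> cancel f g -> cancel g f ->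
      generated_group S g.

Definition reflection_group (g0 g1 g2 : geodesic) : set (R[i] -> R[i]) :=
  generated_group
    [set geodesic_reflection g0; geodesic_reflection g1; geodesic_reflection g2].

(** The limit set does not depend on the orbit; we take that of 0. *)
Definition limit_set (G : set (R[i] -> R[i])) : set R[i] :=
  closure [set f 0 | f in G] `&` unit_circle.

Definition has_distances (d0 d1 d2 : R) (g0 g1 g2 : geodesic) : Prop :=
  [/\ geodesic_dist g1 g2 = d0, geodesic_dist g2 g0 = d1 &
      geodesic_dist g0 g1 = d2].

(** For d0, d1, d2 > 0 the set below is a singleton, because the configuration
    exists and is unique up to isometry. *)
Definition D (d0 d1 d2 : R) : \bar R :=
  xget 0%E [set x | exists g0 g1 g2 : geodesic,
    [/\ non_nested g0 g1 g2, has_distances d0 d1 d2 g0 g1 g2 &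
        x = hausdorff_dim (limit_set (reflection_group g0 g1 g2))]].

End HyperbolicDisk.

(* Main.v *)
Require Import Defs.
From mathcomp Require Import all_boot all_order all_algebra.
From mathcomp Require Import all_reals.
From mathcomp Require Import all_classical all_analysis.
From mathcomp Require Import complex.
From mathcomp Require Import ring lra.

(** Let g0, g1, g2 be non-nested with d(g1, g2) = 2b and
    d(g2, g0) = d(g0, g1) = a, and write r_i for the reflection in g_i. The
    hexagon that they bound is symmetric: the geodesic m that is the
    perpendicular bisector of the common perpendicular of g1 and g2 is
    orthogonal to g0, and its reflection s exchanges g1 and g2. Hence
    d(m, g1) = b, the group generated by r_0, r_1, r_2 has index at most two in
    the group G generated by r_0, s, r_1, and G is unchanged when g0 and m
    trade roles. After the exchange the second subgroup of index at most two
    is generated by s, r_1 and r_0 r_1 r_0, the reflections in m, g1 and r_0(g1);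
    these geodesics are again non-nested, and their distances are 2a (between
    g1 and r_0(g1)) and b, b. Both subgroups have the limit set of G. So the
    set of dimensions realised by the distances (2b, a, a) is contained in the
    one realised by (2a, b, b) [isosceles_swap], by symmetry the two sets are
    equal, and D depends only on that set.

    The geometry is computed in the hyperboloid model. The disk is lifted to
    the sheet <X, X> = -1, X_t > 0 of Minkowski space, where the distance d of
    two points satisfies cosh d = - <X, Y>. A geodesic is the trace of the plane
    orthogonal to a unit spacelike vector v, given up to sign, and its
    reflection lifts to X |-> X - 2 <X, v> v. Everything is then read off from
    the products of these vectors:
    - the distance of two geodesics has hyperbolic cosine max(1, |<v, w>|)
      [geodesic_dist_cosh], so a positive distance d means |<v, w>| = cosh d;
    - if <v, w> < -1 then v + w is timelike, and the time cone that contains it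
      determines on which side of v the geodesic of w lies. Hence three vectors
      with pairwise products below -1 are non-nested, while a triple with
      products of signs (-, -, +) is nested in the isosceles case
      [not_separates_of_mink, separates_of_mink].

    For the limit sets, elements of the two subgroups differ by a factor r_0, so
    each point of the first orbit of 0 is in the second orbit of 0 or in that of
    r_0(0) [limit_set_sub]. Points of these two orbits can be paired at a fixed
    hyperbolic distance, hence at a Euclidean distance that vanishes at the unit
    circle [limit_points_sub]. *)

Set Implicit Arguments.
Unset Strict Implicit.
Unset Printing Implicit Defensive.

Import Order.TTheory GRing.Theory Num.Theory.
Import numFieldNormedType.Exports.
Import Normc.

Local Open Scope classical_set_scope.
Local Open Scope ring_scope.
Local Notation Re := complex.Re.
Local Notation Im := complex.Im.

(** * Minkowski space of signature (2,1) *)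

Record vec (R : Type) := Vec { xcoord : R; ycoord : R; time : R }.

Section Minkowski.
Variable R : realType.
Local Notation vec := (vec R).
Implicit Types (u v w : vec) (c : R).

Definition mink u v : R :=
  xcoord u * xcoord v + ycoord u * ycoord v - time u * time v.

Definition vadd u v : vec :=
  Vec (xcoord u + xcoord v) (ycoord u + ycoord v) (time u + time v).
Definition vscale c v : vec := Vec (c * xcoord v) (c * ycoord v) (c * time v).
Definition vopp v : vec := Vec (- xcoord v) (- ycoord v) (- time v).

Lemma vec_eqP u v :
  xcoord u = xcoord v -> ycoord u = ycoord v -> time u = time v -> u = v.
Proof. by case: u v => [? ? ?] [? ? ?] /= -> -> ->. Qed.

Lemma minkC u v : mink u v = mink v u.
Proof. by rewrite /mink; ring. Qed.

Lemma minkDl u v w : mink (vadd u v) w = mink u w + mink v w.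
Proof. by rewrite /mink /=; ring. Qed.

Lemma minkZl c u v : mink (vscale c u) v = c * mink u v.
Proof. by rewrite /mink /=; ring. Qed.

Lemma minkNl u v : mink (vopp u) v = - mink u v.
Proof. by rewrite /mink /=; ring. Qed.

Lemma minkDr u v w : mink w (vadd u v) = mink w u + mink w v.
Proof. by rewrite minkC minkDl !(minkC _ w). Qed.

Lemma minkZr c u v : mink v (vscale c u) = c * mink v u.
Proof. by rewrite minkC minkZl minkC. Qed.

Lemma minkNr u v : mink v (vopp u) = - mink v u.
Proof. by rewrite minkC minkNl minkC. Qed.

Definition minkE := (minkDl, minkDr, minkNl, minkNr, minkZl, minkZr).

(** The Gram determinant of three vectors is minus the square of their
    determinant, because the form has signature (2,1). *)
Lemma gram_le0 u v w :
  mink u u * mink v v * mink w w + 2 * mink u v * mink v w * mink w u -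
  mink u u * mink v w ^+ 2 - mink v v * mink w u ^+ 2 -
  mink w w * mink u v ^+ 2 <= 0.
Proof.
pose d := xcoord u * (ycoord v * time w - time v * ycoord w)
  - ycoord u * (xcoord v * time w - time v * xcoord w)
  + time u * (xcoord v * ycoord w - ycoord v * xcoord w).
rewrite [X in X <= _](_ : _ = - d ^+ 2) ?oppr_le0 ?sqr_ge0 //.
by rewrite /d /mink; ring.
Qed.

(** The reversed Cauchy-Schwarz inequality: the time coordinates dominate the
    product of two timelike vectors, so its sign tells whether they lie in the
    same time cone. *)
Lemma time_cone u v : mink u u < 0 -> mink v v < 0 ->
  (mink u v < 0) = (0 < time u * time v) /\ mink u v != 0.
Proof.
case: u v => [a b t] [a' b' t']; rewrite /mink /= => hu hv.
set p := a * a' + b * b'.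
have hlt : p ^+ 2 < (t * t') ^+ 2.
  apply: (@le_lt_trans _ _ ((a ^+ 2 + b ^+ 2) * (a' ^+ 2 + b' ^+ 2))).
    rewrite -subr_ge0.
    have -> : (a ^+ 2 + b ^+ 2) * (a' ^+ 2 + b' ^+ 2) - p ^+ 2 =
      (a * b' - b * a') ^+ 2 by rewrite /p; ring.
    exact: sqr_ge0.
  rewrite exprMn; apply: ltr_pM; try by rewrite addr_ge0 ?sqr_ge0.
    by rewrite !expr2; lra.
  by rewrite !expr2; lra.
have hn : `|p| < `|t * t'|.
  by rewrite -(ltr_pXn2r (n := 2)) ?nnegrE// !real_normK ?num_real.
case: (ltrgt0P (t * t')) hn => h.
- by rewrite ltr_norml => /andP[h1 h2]; split; [lra|apply/eqP; lra].
- by rewrite ltr_norml => /andP[h1 h2]; split; [lra|apply/eqP; lra].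
- by rewrite ltNge normr_ge0.
Qed.

(** The Lorentz reflection in the plane orthogonal to u, for <u, u> = 1. *)
Definition lref u v : vec := vadd v (vscale (- (2 * mink u v)) u).

Lemma lrefN u v : lref (vopp u) v = lref u v.
Proof. by rewrite /lref minkNl; apply: vec_eqP => /=; ring. Qed.

Lemma mink_lref u v w : mink u u = 1 -> mink (lref u v) (lref u w) = mink v w.
Proof. by move=> hu; rewrite /lref !minkE hu (minkC v u); ring. Qed.

Lemma lref_conj u v w : mink u u = 1 ->
  lref (lref u v) w = lref u (lref v (lref u w)).
Proof.
move=> hu; rewrite /lref !minkE hu (minkC v u).
by apply: vec_eqP => /=; ring.
Qed.

End Minkowski.

(** * The hyperbolic cosine *)

Section Cosh.
Variable R : realType.
Implicit Types x y : R.

Definition cosh x : R := (expR x + expR (- x)) / 2.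

Lemma cosh0 : cosh 0 = 1.
Proof. by rewrite /cosh oppr0 expR0; field. Qed.

Lemma cosh_lt x y : 0 <= x -> x < y -> cosh x < cosh y.
Proof.
move=> x0 xy; have xy' : expR x < expR y by rewrite ltr_expR.
have h1 : 1 <= expR x by rewrite -expR0 ler_expR.
rewrite /cosh !expRN -subr_gt0.
have -> : (expR y + (expR y)^-1) / 2 - (expR x + (expR x)^-1) / 2 =
   (expR y - expR x) * (1 - (expR x)^-1 * (expR y)^-1) / 2.
  by field; rewrite !gt_eqF ?expR_gt0.
rewrite divr_gt0// mulr_gt0 ?subr_gt0// -invfM invf_lt1 ?mulr_gt0 ?expR_gt0//.
by apply: (le_lt_trans h1); rewrite ltr_pMr ?expR_gt0//; lra.
Qed.

Lemma cosh_le x y : 0 <= x -> 0 <= y -> (cosh x <= cosh y) = (x <= y).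
Proof.
move=> x0 y0; apply/idP/idP => [|]; last first.
  by rewrite le_eqVlt => /predU1P[->//|/(cosh_lt x0)/ltW].
by rewrite !leNgt; apply: contra => /(cosh_lt y0).
Qed.

Lemma cosh_inj x y : 0 <= x -> 0 <= y -> cosh x = cosh y -> x = y.
Proof.
by move=> x0 y0 /eqP; rewrite eq_le !cosh_le// -eq_le => /eqP.
Qed.

Lemma cosh_gt1 x : 0 < x -> 1 < cosh x.
Proof. by move=> x0; rewrite -cosh0 cosh_lt. Qed.

Lemma cosh_double x : cosh (2 * x) = 2 * cosh x ^+ 2 - 1.
Proof.
rewrite /cosh (mulrC 2 x) -mulNr !expRM_natr !expRN.
by field; rewrite gt_eqF ?expR_gt0.
Qed.

Lemma cosh_ln x : 0 < x -> cosh (ln x) = (x + x^-1) / 2.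
Proof. by move=> x0; rewrite /cosh expRN lnK ?posrE. Qed.

Lemma cosh_surj x : 1 <= x -> exists2 d, 0 <= d & cosh d = x.
Proof.
move=> x1; set s := Num.sqrt (x ^+ 2 - 1).
have s0 : 0 <= s by rewrite sqrtr_ge0.
have s2 : s ^+ 2 = x ^+ 2 - 1.
  by rewrite sqr_sqrtr // subr_ge0 exprn_ege1.
exists (ln (x + s)); first by rewrite ln_ge0//; lra.
rewrite cosh_ln; last by lra.
have -> : (x + s)^-1 = x - s.
  apply: (@mulfI _ (x + s)); first by rewrite gt_eqF//; lra.
  rewrite divff ?gt_eqF//; last by lra.
  have -> : (x + s) * (x - s) = x ^+ 2 - s ^+ 2 by ring.
  by rewrite s2; ring.
by field.
Qed.

End Cosh.

(** * The disk as a sheet of the hyperboloid *)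

Section Hyperboloid.
Variable R : realType.
Local Notation vec := (vec R).
Implicit Types (z w : R[i]) (X Y : vec).

Definition sqn z : R := Re z ^+ 2 + Im z ^+ 2.

Lemma sqn_ge0 z : 0 <= sqn z.
Proof. by rewrite addr_ge0 ?sqr_ge0. Qed.

Lemma sqnB z w : sqn (z - w) = (Re z - Re w) ^+ 2 + (Im z - Im w) ^+ 2.
Proof. by case: z w => [? ?] [? ?]. Qed.

Lemma normc_sqrt z : normc z = Num.sqrt (sqn z).
Proof. by case: z. Qed.

Lemma normc_ge0 z : 0 <= normc z.
Proof. by rewrite normc_sqrt sqrtr_ge0. Qed.

Lemma normc_sqr z : normc z ^+ 2 = sqn z.
Proof. by rewrite normc_sqrt sqr_sqrtr ?sqn_ge0. Qed.

Lemma unit_diskE z : unit_disk z <-> sqn z < 1.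
Proof.
rewrite /unit_disk /= -normc_sqr.
by split => h; [rewrite expr_lt1 ?normc_ge0|rewrite -(expr_lt1 (n := 2)) ?normc_ge0].
Qed.

(** Inverse of the stereographic projection of the hyperboloid from (0, 0, -1). *)
Definition hlift z : vec :=
  Vec (2 * Re z / (1 - sqn z)) (2 * Im z / (1 - sqn z))
      ((1 + sqn z) / (1 - sqn z)).

Definition hyperboloid X := mink X X = -1 /\ 0 < time X.

Definition hproj X : R[i] :=
  Complex (xcoord X / (1 + time X)) (ycoord X / (1 + time X)).

Lemma hlift_hyperboloid z : unit_disk z -> hyperboloid (hlift z).
Proof.
move=> /unit_diskE hz; have h := sqn_ge0 z; split; last first.
  by rewrite /= divr_gt0//; lra.
by rewrite /mink /=; move: hz; rewrite /sqn => hz; field; lra.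
Qed.

Lemma hliftK z : unit_disk z -> hproj (hlift z) = z.
Proof.
move=> /unit_diskE; have := sqn_ge0 z; case: z => x y h0 h1.
by rewrite /hproj /=; congr Complex; field; apply/andP; split; lra.
Qed.

Lemma sqn_hproj X : hyperboloid X -> sqn (hproj X) = (time X - 1) / (time X + 1).
Proof.
case: X => [x y t] [] /=; rewrite /mink /sqn /= => h1 h2.
have hxy : x * x + y * y = (t - 1) * (t + 1) by rewrite -[LHS](subrK (t * t)) h1; ring.
have -> : (x / (1 + t)) ^+ 2 + (y / (1 + t)) ^+ 2 =
  (x * x + y * y) / (1 + t) ^+ 2 by field; lra.
by rewrite hxy; field; lra.
Qed.

Lemma hproj_disk X : hyperboloid X -> unit_disk (hproj X).
Proof.
move=> hX; apply/unit_diskE; rewrite sqn_hproj//.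
by case: hX => _ h; rewrite ltr_pdivrMr; lra.
Qed.

Lemma hprojK X : hyperboloid X -> hlift (hproj X) = X.
Proof.
move=> hX; rewrite /hlift sqn_hproj//; case: hX => _.
case: X => [x y t]; rewrite /= => h.
by congr Vec; field; apply/andP; split; lra.
Qed.

Lemma mink_hlift z w : unit_disk z -> unit_disk w ->
  - mink (hlift z) (hlift w) =
    1 + 2 * sqn (z - w) / ((1 - sqn z) * (1 - sqn w)).
Proof.
move=> /unit_diskE + /unit_diskE.
rewrite sqnB /mink /hlift /sqn /= => h1 h2; field; apply/andP; split; lra.
Qed.

(** At a fixed hyperbolic distance, the Euclidean distance tends to 0 when one
    of the points tends to the unit circle. *)
Lemma sqn_hlift z w : unit_disk z -> unit_disk w ->
  sqn (z - w) = (- mink (hlift z) (hlift w) - 1) / 2 * ((1 - sqn z) * (1 - sqn w)).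
Proof.
move=> hz hw; rewrite mink_hlift//; move/unit_diskE: hz => hz.
by move/unit_diskE: hw => hw; field; apply/andP; split; lra.
Qed.

(** With t the quotient in [hyp_dist], the distance ln ((1 + t) / (1 - t)) has
    hyperbolic cosine (1 + t^2) / (1 - t^2), and
    |1 - z conj(w)|^2 = |z - w|^2 + (1 - |z|^2) (1 - |w|^2). *)
Lemma cosh_hyp_dist z w : unit_disk z -> unit_disk w ->
  0 <= hyp_dist z w /\ cosh (hyp_dist z w) = - mink (hlift z) (hlift w).
Proof.
move=> hz hw; rewrite mink_hlift// /hyp_dist.
set t := _ / normc (1 - _).
have hN : sqn (1 - z * conjc w) = sqn (z - w) + (1 - sqn z) * (1 - sqn w).
  by case: (z) (w) => [x y] [x' y']; rewrite /sqn /=; ring.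
move/unit_diskE: hz => hz; move/unit_diskE: hw => hw.
have hp : 0 < (1 - sqn z) * (1 - sqn w) by rewrite mulr_gt0// subr_gt0.
have hq := sqn_ge0 (z - w).
have t0 : 0 <= t by rewrite divr_ge0 ?normc_ge0.
have t2 : t ^+ 2 = sqn (z - w) / (sqn (z - w) + (1 - sqn z) * (1 - sqn w)).
  by rewrite /t expr_div_n !normc_sqr hN.
have t1 : t < 1.
  rewrite -(expr_lt1 (n := 2))// t2 ltr_pdivrMr; lra.
split; first by rewrite ln_ge0// ler_pdivlMr; lra.
rewrite cosh_ln; last by rewrite divr_gt0; lra.
have -> : ((1 + t) / (1 - t) + ((1 + t) / (1 - t))^-1) / 2 =
  (1 + t ^+ 2) / (1 - t ^+ 2).
  by field; rewrite !gt_eqF ?expr_lt1 ?subr_gt0 ?expr_lt1//; lra.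
rewrite t2; move: hp hq; set p := _ * _; set q := sqn _ => hp hq.
by field; rewrite !gt_eqF//; lra.
Qed.

End Hyperboloid.

(** * Geodesics as unit spacelike vectors *)

Section Representation.
Variable R : realType.
Local Notation vec := (vec R).
Implicit Types (z w c : R[i]) (u v : vec) (C : circline R) (g : geodesic R).

(** Only the action inside the disk is recorded, and v is determined up to sign,
    so that a circle and a diameter are treated alike from here on. *)
Definition represents v C :=
  [/\ mink v v = 1,
      forall z, unit_disk z -> carrier C z <-> mink v (hlift z) = 0 &
      forall z, unit_disk z ->
        unit_disk (reflection C z) /\
        hlift (reflection C z) = lref v (hlift z)].

Lemma represents_opp v C : represents v C -> represents (vopp v) C.
Proof.
move=> [h1 h2 h3]; split=> [|z hz|z hz].
- by rewrite !minkE opprK.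
- by rewrite h2// minkNl; split => [->|/eqP]; rewrite ?oppr0// oppr_eq0 => /eqP.
- by rewrite lrefN; exact: h3.
Qed.

Lemma lref_scale (r : R) (v w : vec) : lref (vscale r^-1 v) w =
  vadd w (vscale (- (2 * mink v w / r ^+ 2)) v).
Proof.
rewrite /lref minkE; have [->|r0] := eqVneq r 0.
  by apply: vec_eqP => /=; rewrite (expr2 0) mulr0 !invr0; ring.
by apply: vec_eqP => /=; field.
Qed.

Lemma innerE z w : inner z w = Re z * Re w + Im z * Im w.
Proof. by case: z w => [x y] [x' y']; rewrite /inner /=; ring. Qed.

Lemma inversionE c (r : R) z : c + (r ^+ 2)%:C%C / conjc (z - c) =
  Complex (Re c + r ^+ 2 * (Re z - Re c) / sqn (z - c))
          (Im c + r ^+ 2 * (Im z - Im c) / sqn (z - c)).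
Proof.
case: z c => [x y] [p q]; rewrite /sqn.
rewrite -[LHS]/(Complex _ _) /=; congr Complex; rewrite sqrrN; ring.
Qed.

(** The vector is (c, 1) / r. Its product with the lift of z is minus the
    power of z with respect to the circle, up to a positive factor,
    since |c|^2 = 1 + r^2 by orthogonality to the unit circle. *)
Lemma circle_represents c (r : R) : 0 < r -> sqn c = 1 + r ^+ 2 ->
  represents (vscale r^-1 (Vec (Re c) (Im c) 1)) (Circle c r).
Proof.
move=> r0 hc; have r2 : r ^+ 2 = Re c ^+ 2 + Im c ^+ 2 - 1.
  by move: hc; rewrite /sqn; lra.
have hl z : unit_disk z -> mink (Vec (Re c) (Im c) 1) (hlift z) =
    (r ^+ 2 - sqn (z - c)) / (1 - sqn z).
  move=> /unit_diskE hz; rewrite r2 /mink /= sqnB.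
  by move: hz; rewrite /sqn => hz; field; lra.
split.
- rewrite !minkE /mink /= (_ : _ - _ = r ^+ 2); last by rewrite r2; ring.
  by field; rewrite gt_eqF.
- move=> z hz; rewrite minkE hl// /carrier /= normc_sqrt.
  move/unit_diskE : hz => hz; split=> [h|/eqP].
    rewrite -(sqr_sqrtr (sqn_ge0 (z - c))) h subrr; ring.
  rewrite mulf_eq0 invr_eq0 gt_eqF//= mulf_eq0 invr_eq0.
  rewrite [1 - _ == 0]gt_eqF ?subr_gt0// orbF subr_eq0 => /eqP <-.
  by rewrite sqrtr_sqr gtr0_norm.
- move=> z hz; rewrite lref_scale hl// /reflection inversionE.
  move/unit_diskE : hz => hz.
  have N0 : sqn (z - c) != 0.
    apply/eqP => h; move: hc; suff -> : c = z by have := sqr_ge0 r; lra.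
    by apply/esym/eqP; rewrite -subr_eq0 (@eq0_normc _ (z - c))// normc_sqrt h sqrtr0.
  set w := Complex _ _.
  have hw : 1 - sqn w = r ^+ 2 * (1 - sqn z) / sqn (z - c).
    by move: N0; rewrite /w r2 sqnB /sqn /= => N0; field.
  have r20 : 0 < r ^+ 2 by rewrite exprn_gt0.
  split.
    apply/unit_diskE; rewrite -subr_gt0 hw divr_gt0 ?mulr_gt0 ?subr_gt0//.
    by rewrite lt_def N0 sqn_ge0.
  have hw' : 1 + sqn w = 2 - r ^+ 2 * (1 - sqn z) / sqn (z - c) by lra.
  have hz' : 1 - sqn z != 0 by rewrite gt_eqF ?subr_gt0.
  have r20' : r ^+ 2 != 0 by rewrite gt_eqF.
  rewrite /hlift hw hw'; apply: vec_eqP => /=; move: N0 hz' r20';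
    by rewrite r2 sqnB /sqn => *; field; do ?[apply/andP; split].
Qed.

Lemma line_represents c : c != 0 ->
  represents (vscale (normc c)^-1 (Vec (Re c) (Im c) 0)) (Line c 0).
Proof.
move=> c0; have N0 : sqn c != 0.
  by apply: contra c0 => /eqP h; apply/eqP/eq0_normc; rewrite normc_sqrt h sqrtr0.
have r0 : normc c != 0 by apply: contra c0 => /eqP/eq0_normc ->.
have hl z : mink (Vec (Re c) (Im c) 0) (hlift z) = 2 * inner c z / (1 - sqn z).
  by rewrite innerE /mink /=; ring.
split.
- rewrite !minkE /mink /= mulr0 subr0 -!expr2 -/(sqn c) -normc_sqr.
  by field.
- move=> z /unit_diskE hz; rewrite minkE hl /carrier /=.
  split=> [->|/eqP]; first by ring.
  rewrite mulf_eq0 invr_eq0 (negPf r0)/= mulf_eq0 invr_eq0.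
  rewrite [1 - _ == 0]gt_eqF ?subr_gt0// orbF mulf_eq0 pnatr_eq0.
  by move=> /eqP.
- move=> z /unit_diskE hz; rewrite lref_scale hl normc_sqr /reflection subr0.
  have -> : inner c c = sqn c by rewrite innerE.
  set k := _ / _; have -> : z - k%:C%C * c =
      Complex (Re z - k * Re c) (Im z - k * Im c).
    case: (z) (c) => [x y] [p q]; rewrite -[LHS]/(Complex _ _) /=.
    by congr Complex; ring.
  have hw : sqn (Complex (Re z - k * Re c) (Im z - k * Im c)) = sqn z.
    by move: N0; rewrite /k innerE /sqn /= => N0; field.
  split; first by apply/unit_diskE; rewrite hw.
  have hz' : 1 - sqn z != 0 by rewrite gt_eqF ?subr_gt0.
  by rewrite /hlift hw /k; apply: vec_eqP => /=; field; rewrite ?N0 ?hz'.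
Qed.

Lemma geodesic_represented g : exists v, represents v (Defs.support g).
Proof.
case: g => [[c r|c k] /= hn [[w []]]] /=.
- rewrite /unit_circle /= !normc_sqrt => h1 h2 /(_ w) h.
  have {}h : inner (w - c) w = 0 by apply: h; split; rewrite /= normc_sqrt.
  have {}h1 : sqn (w - c) = r ^+ 2 by rewrite -h1 sqr_sqrtr ?sqn_ge0.
  have {}h2 : sqn w = 1 by rewrite -[LHS]sqr_sqrtr ?sqn_ge0// h2 expr1n.
  eexists; apply: circle_represents => //.
  move: h h1 h2; rewrite sqnB innerE /sqn.
  by case: (w) (c) => [x y] [p q] /= h h1 h2; lra.
- move=> h1 h2 /(_ w) h; have {}h : inner c w = 0 by apply: h.
  by move: h1; rewrite h => <-; eexists; exact: line_represents.
Qed.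

(** The vector (x, y, t) is carried by the circle of center (x, y) / t and radius
    1 / |t|, or by a line through 0 if t = 0; the sign of t is absorbed by
    [represents_opp]. *)
Lemma geodesic_exists v : mink v v = 1 -> exists g, represents v (Defs.support g).
Proof.
case: v => x y t hv; have hv' : x ^+ 2 + y ^+ 2 = 1 + t ^+ 2.
  by move: hv; rewrite /mink /= -!expr2 => <-; ring.
have [t0|t0] := eqVneq t 0.
  pose c := Complex x y.
  have hc : sqn c = 1 by rewrite /sqn /= hv' t0; ring.
  have c0 : c != 0.
    by apply/eqP => h; move: hc; rewrite h /sqn /= expr0n/=; lra.
  have ho : meets_unit_circle_orthogonally (Line c 0).
    split=> [|z []//]; exists (Complex (- y) x); split => /=.
      by rewrite innerE /=; ring.
    by rewrite /unit_circle /= sqrrN addrC hv' t0 expr0n addr0 sqrtr1.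
  exists (@Geodesic R (Line c 0) c0 ho) => /=.
  have := line_represents c0; congr represents.
  rewrite normc_sqrt hc sqrtr1 invr1 t0; apply: vec_eqP => /=; ring.
pose c := Complex (x / t) (y / t); pose r := `|t|^-1.
have r0 : 0 < r by rewrite invr_gt0 normr_gt0.
have r2 : r ^+ 2 = t ^- 2 by rewrite /r exprVn real_normK ?num_real.
have hc : sqn c = 1 + r ^+ 2.
  rewrite /sqn /= r2 !expr_div_n -mulrDl hv'; field => //.
have ho : meets_unit_circle_orthogonally (Circle c r).
  have h1t : 1 + t ^+ 2 != 0 by rewrite gt_eqF// ltr_wpDr ?sqr_ge0.
  split=> [|z []] /=.
    (* One of the two ends of the geodesic, (x + i y) (t + i) / (1 + t^2). *)
    pose w := Complex ((x * t - y) / (1 + t ^+ 2)) ((y * t + x) / (1 + t ^+ 2)).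
    have hw : sqn w = 1.
      rewrite /sqn /w /= !expr_div_n -mulrDl.
      rewrite (_ : (x * t - y) ^+ 2 + _ =
        (x ^+ 2 + y ^+ 2) * (1 + t ^+ 2)); last by ring.
      by rewrite hv'; field.
    have hwc : inner c w = 1.
      rewrite innerE /= (_ : _ + _ = (x ^+ 2 + y ^+ 2) / (1 + t ^+ 2)).
        by rewrite hv' divff.
      by field; rewrite t0 h1t.
    exists w; split; [change (normc (w - c) = r)|change (normc w = 1)];
      rewrite normc_sqrt.
      have -> : sqn (w - c) = r ^+ 2.
        move: hw hwc hc; rewrite sqnB innerE /sqn.
        by case: (w) (c) => [? ?] [? ?] /= *; lra.
      by rewrite sqrtr_sqr gtr0_norm.
    by rewrite hw sqrtr1.
  rewrite /unit_circle /= !normc_sqrt => h1 h2.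
  have {}h1 : sqn (z - c) = r ^+ 2 by rewrite -h1 sqr_sqrtr ?sqn_ge0.
  have {}h2 : sqn z = 1 by rewrite -[LHS]sqr_sqrtr ?sqn_ge0// h2 expr1n.
  move: h1 h2 hc; rewrite sqnB innerE /sqn.
  by case: (z) (c) => [? ?] [? ?] /= *; lra.
exists (@Geodesic R (Circle c r) r0 ho) => /=.
have := circle_represents r0 hc; rewrite /r invrK /=.
case: (ltrgt0P t) t0 => //= t0 _.
  by congr represents; apply: vec_eqP => /=; field; rewrite ?gt_eqF.
move/represents_opp; congr represents.
by apply: vec_eqP => /=; field; rewrite ?lt_eqF.
Qed.

Lemma reflectionK C : Defs.nondegenerate C -> cancel (reflection C) (reflection C).
Proof.
case: C => [c r|c k] h z; rewrite /Defs.reflection; rewrite /= in h.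
  rewrite [c + _ - c]addrAC subrr add0r.
  have q0 : (r ^+ 2)%:C%C != 0 by rewrite eq_complex /= sqrf_eq0 gt_eqF.
  have hq : conjc ((r ^+ 2)%:C%C) = (r ^+ 2)%:C%C by rewrite conjc_real.
  move: q0 hq; set q := (_ %:C)%C => q0 hq.
  have conjM a b : conjc (a * b : R[i]) = conjc a * conjc b by exact: rmorphM.
  rewrite conjM conjc_inv conjcK hq.
  have [/eqP|z0] := eqVneq (z - c) 0.
    by rewrite subr_eq0 => /eqP ->; rewrite subrr invr0 mulr0 invr0 mulr0 addr0.
  have cancel_inv (F : fieldType) (a b : F) : a != 0 -> a / (a / b) = b.
    by move=> a0; rewrite invf_div mulrCA divff ?mulr1.
  by rewrite cancel_inv// addrC subrK.
have N0 : inner c c != 0.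
  apply: contra h => /eqP; rewrite innerE -!expr2 => hc.
  by apply/eqP/eq0_normc; rewrite normc_sqrt [sqn _]hc sqrtr0.
set a := _ / _; have -> : inner c (z - a%:C%C * c) = inner c z - a * inner c c.
  rewrite !innerE; case: (z) (c) => [x y] [p q] /=; ring.
have -> : 2 * (inner c z - a * inner c c - k) / inner c c = - a.
  by rewrite /a; field.
by rewrite rmorphN mulNr opprK subrK.
Qed.

End Representation.

(** * The distance between two geodesics *)

Section Distance.
Variable R : realType.
Local Notation vec := (vec R).
Implicit Types (z w c : R[i]) (u v : vec) (C : circline R) (g : geodesic R).

(** The infimum over L > 0 of (sqrt L p + q / sqrt L)^2 is max(0, 4 p q); it is
    attained unless exactly one of p and q is 0. *)
Lemma weighted_sum_small (p q e : R) : 0 < e ->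
  exists2 L, 0 < L & L * p ^+ 2 + 2 * (p * q) + q ^+ 2 / L <=
                     Num.max 0 (4 * (p * q)) + e.
Proof.
move=> e0; have [p0|p0] := eqVneq p 0.
  have q1 : 0 < q ^+ 2 + 1 by rewrite ltr_wpDl ?sqr_ge0.
  exists ((q ^+ 2 + 1) / e); first by rewrite divr_gt0.
  rewrite p0 expr0n /= !(mul0r, mulr0) !add0r maxxx add0r.
  rewrite invf_div mulrA ler_pdivrMr// mulrC ler_pM2l//; lra.
have [q0|q0] := eqVneq q 0.
  have q1 : 0 < p ^+ 2 + 1 by rewrite ltr_wpDl ?sqr_ge0.
  exists (e / (p ^+ 2 + 1)); first by rewrite divr_gt0.
  rewrite q0 expr0n /= !(mul0r, mulr0) !addr0 maxxx add0r.
  rewrite mulrAC ler_pdivrMr// ler_pM2l//; lra.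
have pq0 : p * q != 0 by rewrite mulf_neq0.
have h L : 0 < L -> L * p ^+ 2 + 2 * (p * q) + q ^+ 2 / L <=
    Num.max 0 (4 * (p * q)) ->
  exists2 L, 0 < L & L * p ^+ 2 + 2 * (p * q) + q ^+ 2 / L <=
                     Num.max 0 (4 * (p * q)) + e.
  by move=> L0 hL; exists L => //; lra.
case: (ltrgt0P (p * q)) pq0 => // hpq _; rewrite ?hpq in h.
  apply: (h (p * q / p ^+ 2)); first by rewrite divr_gt0// lt_def sqr_ge0 sqrf_eq0 p0.
  rewrite le_max; apply/orP; right; rewrite [leLHS](_ : _ = 4 * (p * q)) ?lexx//.
  by field; rewrite p0 q0.
apply: (h (- (p * q) / p ^+ 2)).
  by rewrite divr_gt0 ?oppr_gt0// lt_def sqr_ge0 sqrf_eq0 p0.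
rewrite le_max; apply/orP; left; rewrite [leLHS](_ : _ = 0) ?lexx//.
by field; rewrite p0 q0.
Qed.


(** sinh^2 of the distance from Z to the geodesic of w is <w, Z>^2. With P and Q
    lightlike vectors at the two ends of the geodesic of v, the point Z is a
    positive multiple of l P + l^-1 Q, and <w, P> <w, Q> is a positive multiple
    of <v, w>^2 - 1. The slack e is needed because the infimum over Z is not
    attained for asymptotic geodesics. *)
Lemma hyperboloid_point_near v (w : vec) (e : R) :
  mink v v = 1 -> mink w w = 1 -> 0 < e ->
  exists Z, [/\ hyperboloid Z, mink v Z = 0 &
    mink w Z ^+ 2 <= Num.max 0 (mink v w ^+ 2 - 1) + e].
Proof.
move=> hv hw e0; pose N := 1 + time v ^+ 2.
have N0 : 0 < N by rewrite ltr_wpDr ?sqr_ge0.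
pose x := xcoord v; pose y := ycoord v; pose t := time v.
pose P := Vec (x * t - y) (y * t + x) N.
pose Q := Vec (x * t + y) (y * t - x) N.
have hxy : x ^+ 2 + y ^+ 2 = N.
  by rewrite /N -hv /mink /x /y; ring.
have hPP : mink P P = 0.
  rewrite (_ : mink P P = (x ^+ 2 + y ^+ 2) * N - N ^+ 2); last first.
    by rewrite /mink /= /N -/t; ring.
  by rewrite hxy; ring.
have hQQ : mink Q Q = 0.
  rewrite (_ : mink Q Q = (x ^+ 2 + y ^+ 2) * N - N ^+ 2); last first.
    by rewrite /mink /= /N -/t; ring.
  by rewrite hxy; ring.
have hPQ : mink P Q = - 2 * N.
  rewrite (_ : mink P Q = (x ^+ 2 + y ^+ 2) * (t ^+ 2 - 1) - N ^+ 2).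
    by rewrite hxy /N -/t; ring.
  by rewrite /mink /= /N -/t; ring.
have hvP : mink v P = 0.
  rewrite (_ : mink v P = (x ^+ 2 + y ^+ 2) * t - t * N); last first.
    by rewrite /mink /= /N -/t -/x -/y; ring.
  by rewrite hxy; ring.
have hvQ : mink v Q = 0.
  rewrite (_ : mink v Q = (x ^+ 2 + y ^+ 2) * t - t * N); last first.
    by rewrite /mink /= /N -/t -/x -/y; ring.
  by rewrite hxy; ring.
have hpq : mink w P * mink w Q = N * (mink v w ^+ 2 - 1).
  rewrite -hw /mink /= -/x -/y -/t.
  set a := xcoord w; set b := ycoord w; set d := time w.
  (* Lagrange's identity: al^2 + be^2 = (x^2 + y^2) (a^2 + b^2). *)
  pose al := a * x + b * y; pose be := b * x - a * y.
  have hbe : be ^+ 2 = N * (a ^+ 2 + b ^+ 2) - al ^+ 2.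
    by rewrite -hxy /al /be; ring.
  transitivity ((al * t - d * N) ^+ 2 - be ^+ 2); first by rewrite /al /be; ring.
  by rewrite hbe /al /N -/t; ring.
have e4 : 0 < 4 * N * e by rewrite !mulr_gt0.
have [L L0 hL] := weighted_sum_small (mink w P) (mink w Q) e4.
pose l := Num.sqrt L; have l0 : 0 < l by rewrite sqrtr_gt0.
have hl : l ^+ 2 = L by rewrite sqr_sqrtr ?ltW.
pose n := Num.sqrt N; have n0 : 0 < n by rewrite sqrtr_gt0.
have hn : n ^+ 2 = N by rewrite sqr_sqrtr ?ltW.
exists (vscale (2 * n)^-1 (vadd (vscale l P) (vscale l^-1 Q))); split.
- split.
    rewrite !minkE hPP hQQ (minkC Q P) hPQ -hn; field.
    by rewrite !gt_eqF.
  by rewrite /= !mulr_gt0 ?invr_gt0 ?addr_gt0 ?mulr_gt0 ?invr_gt0.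
- by rewrite !minkE hvP hvQ; ring.
- rewrite !minkE.
  rewrite (_ : _ ^+ 2 = (L * mink w P ^+ 2 + 2 * (mink w P * mink w Q) +
     mink w Q ^+ 2 / L) / (4 * N)); last first.
    by rewrite -hl -hn; field; rewrite !gt_eqF.
  rewrite ler_pdivrMr ?mulr_gt0//; apply: (le_trans hL).
  rewrite [leRHS]mulrDl (mulrC e) lerD2r hpq mulrA.
  rewrite ge_max mulr_ge0 ?le_max ?lexx ?mulr_ge0 ?(ltW N0)//=.
  by rewrite mulrC ler_pM2r ?mulr_gt0// le_max lexx orbT.
Qed.

(** X is the foot of the perpendicular from Z to the geodesic of w. *)
Lemma hyperboloid_foot (w Z : vec) : mink w w = 1 -> hyperboloid Z ->
  exists X, [/\ hyperboloid X, mink w X = 0 &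
    mink Z X ^+ 2 = 1 + mink w Z ^+ 2].
Proof.
move=> hw [hZ tZ]; set q := mink w Z.
have h1 : 0 < 1 + q ^+ 2 by rewrite ltr_wpDr ?sqr_ge0.
pose n := Num.sqrt (1 + q ^+ 2); have n0 : 0 < n by rewrite sqrtr_gt0.
have hn : n ^+ 2 = 1 + q ^+ 2 by rewrite sqr_sqrtr ?ltW.
pose X := vscale n^-1 (vadd Z (vscale (- q) w)).
have hX : mink X X = -1.
  rewrite /X !minkE hw hZ (minkC Z w) -/q.
  rewrite (_ : _ * _ = - (1 + q ^+ 2) / n ^+ 2); last by field; rewrite gt_eqF.
  by rewrite -hn mulNr divff// gt_eqF ?exprn_gt0.
have hZX : mink Z X = - n.
  rewrite /X !minkE hZ (minkC Z w) -/q.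
  rewrite (_ : _ * _ = - (1 + q ^+ 2) / n); last by field; rewrite gt_eqF.
  by rewrite -hn; field; rewrite gt_eqF.
exists X; split.
- split=> //.
  have [] := @time_cone _ Z X; rewrite ?hZ ?hX ?hZX ?oppr_lt0//.
  by move=> + _; rewrite n0 pmulr_rgt0.
- by rewrite /X !minkE hw -/q; ring.
- by rewrite hZX sqrrN.
Qed.

(** For Z on the first geodesic and X on the second, the Gram determinants of
    (Z, X, w) and of (v, w, Z) give <Z, X>^2 >= 1 + <w, Z>^2 >= <v, w>^2; the
    bound is approached by a point Z close to the second geodesic and its foot
    X there. *)
Lemma geodesic_dist_cosh v (w : vec) (g h : geodesic R) :
  represents v (Defs.support g) -> represents w (Defs.support h) ->
  0 <= geodesic_dist g h /\
  cosh (geodesic_dist g h) = Num.max 1 `|mink v w|.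
Proof.
move=> [hv hg _] [hw hh _]; set M := Num.max _ _.
have [d d0 hd] : exists2 d, 0 <= d & cosh d = M.
  by apply: cosh_surj; rewrite le_max lexx.
have hd2 : M ^+ 2 = 1 + Num.max 0 (mink v w ^+ 2 - 1).
  rewrite /M -(real_normK (num_real (mink v w))).
  have := normr_ge0 (mink v w); move: `|_| => c c0.
  have [c1|/ltW c1] := leP 1 c.
    by rewrite max_r ?subr_ge0 ?exprn_ege1//; ring.
  by rewrite max_l ?subr_le0 ?exprn_ile1//; ring.
suff -> : geodesic_dist g h = d by [].
rewrite /geodesic_dist; set S := (X in inf X).
have near e : 0 < e -> exists2 r, S r & 0 <= r /\ cosh r ^+ 2 <= M ^+ 2 + e.
  move=> e0; have [Z [hZ vZ wZ]] := hyperboloid_point_near hv hw e0.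
  have [X [hX wX ZX]] := hyperboloid_foot hw hZ.
  have zd := hproj_disk hZ; have xd := hproj_disk hX.
  have [r0 hr] := cosh_hyp_dist zd xd.
  exists (hyp_dist (hproj Z) (hproj X)).
    exists (hproj Z); first by split=> //; apply/(hg _ zd); rewrite hprojK.
    by exists (hproj X) => //; split=> //; apply/(hh _ xd); rewrite hprojK.
  by rewrite hr !hprojK// sqrrN ZX hd2; split => //; lra.
have far r : S r -> d <= r.
  move=> [z [zg zd] [x [xh xd] <-]].
  have [r0 hr] := cosh_hyp_dist zd xd; rewrite -cosh_le// hd hr.
  have [hZ _] := hlift_hyperboloid zd; have [hX _] := hlift_hyperboloid xd.
  have /hg vZ := zg; have /hh wX := xh.
  rewrite /M ge_max -[in X in X && _]cosh0 -{1}hr cosh_le// r0 /=.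
  have C0 : 0 <= - mink (hlift z) (hlift x).
    by rewrite -hr (le_trans ler01)// -cosh0 cosh_le.
  rewrite -(ler_pXn2r (n := 2)) ?nnegrE// real_normK ?num_real//.
  have := gram_le0 (hlift z) (hlift x) w; have := gram_le0 v w (hlift z).
  rewrite hZ hX hw hv (minkC (hlift x) w) wX// (minkC (hlift z) v) vZ//.
  rewrite sqrrN; lra.
have lbS : has_lbound S by exists d.
apply/eqP; rewrite eq_le; apply/andP; split; last first.
  apply: lb_le_inf => //; have [r Sr _] := near 1 ltr01.
  by exists r.
apply/ler_addgt0Pr => e e0.
have hde : M < cosh (d + e) by rewrite -hd cosh_lt// ltrDl.
have M0 : 0 <= M by rewrite le_max ler01.
have e2 : 0 < cosh (d + e) ^+ 2 - M ^+ 2.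
  by rewrite subr_gt0 ltr_pXn2r ?nnegrE// (le_trans M0)// ltW.
have [r Sr [r0]] := near _ e2; rewrite subrKC => hr.
apply: (le_trans (ge_inf lbS Sr)).
rewrite -cosh_le ?addr_ge0 ?(ltW e0)// -(ler_pXn2r (n := 2)) ?nnegrE//.
  by rewrite (le_trans ler01)// -cosh0 cosh_le.
by rewrite (le_trans M0)// ltW.
Qed.

Lemma geodesic_distP v (w : vec) (g h : geodesic R) (d : R) :
  represents v (Defs.support g) -> represents w (Defs.support h) -> 0 < d ->
  geodesic_dist g h = d <-> `|mink v w| = cosh d.
Proof.
move=> hg hh d0; have [r0] := geodesic_dist_cosh hg hh.
have := cosh_gt1 d0; case: (leP 1 `|mink v w|) => h1 h2 h3.
  split=> [<-//|h4]; apply: cosh_inj => //; first exact: ltW.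
  by rewrite h3.
split=> [h4|h4]; first by move: h2; rewrite -h4 h3 ltxx.
by move: h2; rewrite -h4 => /(lt_trans h1); rewrite ltxx.
Qed.

End Distance.

(** * Separation by a geodesic *)

Section Separation.
Variable R : realType.
Local Notation vec := (vec R).
Implicit Types (z w c : R[i]) (u v : vec) (C : circline R) (g : geodesic R).

Lemma normc_ge_coord z : `|Re z| <= normc z /\ `|Im z| <= normc z.
Proof.
rewrite normc_sqrt -!sqrtr_sqr /sqn.
by split; rewrite ler_wsqrtr// ?lerDl ?lerDr sqr_ge0.
Qed.

Lemma normc_le_coord z : normc z <= `|Re z| + `|Im z|.
Proof.
rewrite -(ler_pXn2r (n := 2)) ?nnegrE ?normc_ge0 ?addr_ge0//.
rewrite normc_sqr /sqn sqrrD !real_normK ?num_real//.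
by rewrite lerD2r lerDl mulrn_wge0// mulr_ge0.
Qed.

Lemma normE z : `|z| = (normc z)%:C%C.
Proof. by []. Qed.

Lemma near_normc z (e : R) : 0 < e -> \forall w \near z, normc (z - w) < e.
Proof.
move=> e0; have e0' : 0 < e%:C%C by rewrite ltcR.
apply: filterS (nbhsx_ballx z _ e0') => w.
by rewrite -ball_normE /= normE ltcR.
Qed.

Lemma Re_continuous : continuous (@complex.Re R).
Proof.
move=> z; apply/(@cvgrPdist_lt _ _ _ (nbhs z) (nbhs_filter z)) => e e0.
apply: (@filterS _ (nbhs z) (nbhs_filter z) _ _ _ (near_normc z e0)) => w.
apply: le_lt_trans.
by have [+ _] := normc_ge_coord (z - w); case: (z) (w) => [? ?] [? ?].
Qed.

Lemma Im_continuous : continuous (@complex.Im R).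
Proof.
move=> z; apply/(@cvgrPdist_lt _ _ _ (nbhs z) (nbhs_filter z)) => e e0.
apply: (@filterS _ (nbhs z) (nbhs_filter z) _ _ _ (near_normc z e0)) => w.
apply: le_lt_trans.
by have [_] := normc_ge_coord (z - w); case: (z) (w) => [? ?] [? ?].
Qed.

Lemma Complex_continuous (f g : R -> R) (t : R) :
  {for t, continuous f} -> {for t, continuous g} ->
  {for t, continuous (fun s => Complex (f s) (g s) : R[i])}.
Proof.
move=> hf hg; apply/cvgrPdist_lt => e; rewrite ltcE /= => /andP[/eqP he e0].
have e2 : 0 < Re e / 2 by rewrite divr_gt0.
near=> s; rewrite normE ltcE /= -he eqxx /=.
apply: le_lt_trans (normc_le_coord (Complex (f t - f s) (g t - g s))) _ => /=.
rewrite (splitr (Re e)) ltrD//; near: s.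
  by move/cvgrPdist_lt : hf; apply.
by move/cvgrPdist_lt : hg; apply.
Unshelve. all: by end_near. Qed.

(** A polynomial with the sign of <u, hlift z> on the disk, continuous on the
    whole plane. *)
Definition side u z : R :=
  2 * (xcoord u * Re z + ycoord u * Im z) -
  time u * (1 + (Re z * Re z + Im z * Im z)).

Lemma sideE u z : unit_disk z -> side u z = (1 - sqn z) * mink u (hlift z).
Proof.
move=> /unit_diskE hz; rewrite /side /mink /=.
by move: hz; rewrite /sqn => hz; field; lra.
Qed.

Lemma side_continuous u : continuous (side u).
Proof.
move=> z; have hR := @Re_continuous z; have hI := @Im_continuous z.
have hF := nbhs_filter z.
have hc (k : R) : k @[_ --> z] --> k by exact: cvg_cst.
apply: cvgB; apply: cvgM => //.
  by apply: cvgD; apply: cvgM.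
by apply: cvgD => //; apply: cvgD; apply: cvgM.
Qed.

Lemma opposite_sides_separated u C z w : represents u C ->
  unit_disk z -> unit_disk w ->
  mink u (hlift z) * mink u (hlift w) < 0 ->
  ~ connected_component (@unit_disk R `\` (carrier C `&` @unit_disk R)) z w.
Proof.
move=> [hu hC _] hz hw hzw hc.
set A := _ `\` _ in hc; pose K := connected_component A z.
have Kz : K z.
  apply: connected_component_refl; split=> // -[/hC h _].
  by move: hzw; rewrite h// mul0r ltxx.
have KA : K `<=` A := @connected_component_sub _ A z.
have : connected (side u @` K).
  apply: connected_continuous_connected; first exact: component_connected.
  by apply: continuous_subspaceT; exact: side_continuous.
move/connected_intervalP => hI.
have hs : side u z * side u w < 0.
  have /unit_diskE z1 := hz; have /unit_diskE w1 := hw.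
  rewrite !sideE// mulrACA pmulr_rlt0// mulr_gt0// subr_gt0//.
have [y Ky hy] : (side u @` K) 0.
  case: (ltrgt0P (side u z)) hs => hsz hs; last by rewrite hsz mul0r ltxx in hs.
    apply: (hI (side u w) (side u z)); [by exists w|by exists z|].
    by rewrite (ltW hsz) andbT -(pmulr_rle0 _ hsz) ltW.
  apply: (hI (side u z) (side u w)); [by exists z|by exists w|].
  by rewrite (ltW hsz) -(nmulr_rle0 _ hsz) ltW.
have [yd yC] := KA _ Ky; apply: yC; split=> //; apply/hC => //.
have /unit_diskE y1 := yd; move: hy; rewrite sideE// => /eqP.
by rewrite mulf_eq0 [1 - _ == 0]gt_eqF ?subr_gt0// => /eqP.
Qed.

Lemma convex_gt0 (t a b : R) : 0 <= t -> t <= 1 -> 0 < a -> 0 < b ->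
  0 < (1 - t) * a + t * b.
Proof.
move=> t0 t1 a0 b0; have [->|tn] := eqVneq t 0; first by rewrite subr0; lra.
by rewrite ltr_wpDl ?mulr_ge0 ?subr_ge0 ?(ltW a0)// mulr_gt0// lt_def tn.
Qed.

(** The chord between the lifts of z and w stays in the open half-space of u and
    in the future cone; its radial projection to the hyperboloid is a path from
    z to w that avoids the geodesic. *)
Lemma same_side_connected u C z w : represents u C ->
  unit_disk z -> unit_disk w ->
  0 < mink u (hlift z) * mink u (hlift w) ->
  connected_component (@unit_disk R `\` (carrier C `&` @unit_disk R)) z w.
Proof.
move=> [hu hC _] hz hw hzw.
set A := _ `\` _; set Z := hlift z; set W := hlift w.
have [ZZ tZ] := hlift_hyperboloid hz; have [WW tW] := hlift_hyperboloid hw.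
have ZW : mink Z W < 0.
  have [] := @time_cone _ Z W; rewrite ?ZZ ?WW ?oppr_lt0//.
  by move=> -> _; rewrite mulr_gt0.
pose Y (t : R) := vadd (vscale (1 - t) Z) (vscale t W).
pose rho t := Num.sqrt (- mink (Y t) (Y t)).
pose gam t := hproj (vscale (rho t)^-1 (Y t)).
have hYY t : t \in `[0, 1] -> 0 < - mink (Y t) (Y t).
  rewrite in_itv /= => /andP[t0 t1].
  rewrite /Y !minkE ZZ WW (minkC W Z).
  have h1 : 0 <= t * (1 - t) by rewrite mulr_ge0 ?subr_ge0.
  have h2 : 0 <= t * (1 - t) * - mink Z W by rewrite mulr_ge0// oppr_ge0 ltW.
  rewrite (_ : - _ = ((2 * t - 1) ^+ 2 + 1) / 2 + 2 * (t * (1 - t) * - mink Z W)).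
    apply: ltr_pwDl; last by rewrite mulr_ge0.
    by rewrite divr_gt0// ltr_wpDl ?sqr_ge0.
  by field.
have htY t : t \in `[0, 1] -> 0 < time (Y t).
  rewrite in_itv /= => /andP[t0 t1]; rewrite /Y /=.
  exact: convex_gt0.
have hrho t : t \in `[0, 1] -> 0 < rho t.
  by move=> ht; rewrite sqrtr_gt0 hYY.
have hyp t : t \in `[0, 1] -> hyperboloid (vscale (rho t)^-1 (Y t)).
  move=> ht; have r0 := hrho _ ht; split; last first.
    by rewrite /= mulr_gt0 ?invr_gt0 ?htY.
  have hr2 : mink (Y t) (Y t) = - rho t ^+ 2.
    by rewrite sqr_sqrtr ?opprK// ltW// hYY.
  rewrite minkZl minkZr hr2.
  by field; rewrite gt_eqF.
pose fx t := xcoord (Y t) / rho t / (1 + time (Y t) / rho t).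
pose fy t := ycoord (Y t) / rho t / (1 + time (Y t) / rho t).
have gamE : gam = fun t => Complex (fx t) (fy t).
  by apply/funext => t; rewrite /gam /hproj /= !(mulrC (rho t)^-1).
have gam0 : gam 0 = z.
  rewrite /gam /rho; have -> : Y 0 = Z by apply: vec_eqP => /=; ring.
  rewrite ZZ opprK sqrtr1 invr1.
  have -> : vscale 1 Z = Z by apply: vec_eqP => /=; ring.
  exact: hliftK.
have gam1 : gam 1 = w.
  rewrite /gam /rho; have -> : Y 1 = W by apply: vec_eqP => /=; ring.
  rewrite WW opprK sqrtr1 invr1.
  have -> : vscale 1 W = W by apply: vec_eqP => /=; ring.
  exact: hliftK.
have i0 : `[0, 1]%classic (0 : R) by rewrite /= in_itv /= lexx ler01.
have i1 : `[0, 1]%classic (1 : R) by rewrite /= in_itv /= lexx ler01.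
apply: (@connected_component_max _ _ (gam @` `[0, 1]%classic)).
- by exists 0.
- move=> _ [t ht <-]; have hg := hyp _ ht; have gd := hproj_disk hg.
  split=> // -[/hC + _] => /(_ gd); rewrite hprojK// minkE.
  move/eqP; rewrite mulf_eq0 invr_eq0 gt_eqF ?hrho//= /Y !minkE -/Z -/W => /eqP.
  move: ht hzw; rewrite /= in_itv /= -/Z -/W => /andP[t0 t1].
  move: (mink u Z) (mink u W) => a b hab h.
  have : (1 - t) * a ^+ 2 + t * (a * b) = 0 by rewrite -(mulr0 a) -h; ring.
  have a2 : 0 < a ^+ 2.
    by rewrite exprn_even_gt0//=; apply: contraTneq hab => ->; rewrite mul0r ltxx.
  by apply/eqP; rewrite gt_eqF// convex_gt0.
- apply: connected_continuous_connected; first exact: segment_connected.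
  apply: continuous_in_subspaceT => t; rewrite inE /= => ht.
  have cst_lin (a b : R) : {for t, continuous (fun s : R => (1 - s) * a + s * b)}.
    apply: cvgD; apply: cvgM; [|exact: cvg_cst|exact: cvg_id|exact: cvg_cst].
    by apply: cvgB; [exact: cvg_cst|exact: cvg_id].
  have crho : {for t, continuous rho}.
    apply: (@continuous_comp _ _ _ (fun s => - mink (Y s) (Y s)) Num.sqrt);
      last exact: sqrt_continuous.
    apply: cvgN; apply: cvgB; first apply: cvgD; apply: cvgM; exact: cst_lin.
  have r0 : rho t != 0 by rewrite gt_eqF ?hrho.
  have crhoV : {for t, continuous (fun s => (rho s)^-1)} by exact: cvgV.
  have cden : {for t, continuous (fun s => (1 + time (Y s) / rho s)^-1)}.
    apply: cvgV; first by rewrite gt_eqF// addr_gt0// divr_gt0 ?htY ?hrho.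
    by apply: cvgD; [exact: cvg_cst|apply: cvgM; [exact: cst_lin|]].
  rewrite gamE; apply: (@Complex_continuous fx fy).
    by apply: cvgM => //; apply: cvgM => //; exact: cst_lin.
  by apply: cvgM => //; apply: cvgM => //; exact: cst_lin.
- by exists 1.
Qed.

End Separation.

(** * Non-nested triples *)

Section Triples.
Variable R : realType.
Local Notation vec := (vec R).
Implicit Types (u v w X Z : vec) (g h k : geodesic R).

(** As v is orthogonal to Z, <u, Z> = <u + v, Z>, and u + v is timelike. So the
    side of u on which the geodesic of v lies does not depend on Z. *)
Lemma mink_lt0_time u v Z : mink u u = 1 -> mink v v = 1 -> mink u v < -1 ->
  hyperboloid Z -> mink v Z = 0 ->
  (mink u Z < 0) = (0 < time u + time v) /\ mink u Z != 0.
Proof.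
move=> hu hv huv [ZZ tZ] vZ.
have [] := @time_cone _ (vadd u v) Z.
- by rewrite !minkE (minkC v u) hu hv; lra.
- by rewrite ZZ oppr_lt0.
by rewrite minkDl vZ addr0 => -> ->; rewrite pmulr_lgt0.
Qed.

Lemma time_add_timelike u v w :
  mink u u = 1 -> mink v v = 1 -> mink w w = 1 ->
  mink u v < -1 -> mink u w < -1 -> mink v w < -1 ->
  0 < (time u + time v) * (time u + time w).
Proof.
move=> hu hv hw huv huw hvw.
have [] := @time_cone _ (vadd u v) (vadd u w).
- by rewrite !minkE (minkC v u) hu hv; lra.
- by rewrite !minkE (minkC w u) hu hw; lra.
by move=> <- _; rewrite !minkE (minkC v u) hu; lra.
Qed.

Lemma geodesic_point v g : represents v (Defs.support g) ->
  exists2 z, geodesic_set g z & unit_disk z.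
Proof.
move=> [hv hg _]; have [Z [hZ vZ _]] := hyperboloid_point_near hv hv ltr01.
have zd := hproj_disk hZ; exists (hproj Z) => //; split=> //.
by apply/(hg _ zd); rewrite hprojK.
Qed.

Lemma geodesic_mink v g z : represents v (Defs.support g) -> geodesic_set g z ->
  mink v (hlift z) = 0.
Proof. by move=> [_ hg _] [hz zd]; apply/hg. Qed.

Lemma disjoint_of_mink v w g h :
  represents v (Defs.support g) -> represents w (Defs.support h) ->
  mink v w < -1 -> disjoint_geodesics g h.
Proof.
move=> hg hh hvw; rewrite /disjoint_geodesics -subset0 => z [zg zh].
have [hv _ _] := hg; have [hw _ _] := hh.
have [_] := mink_lt0_time hv hw hvw (hlift_hyperboloid zg.2) (geodesic_mink hh zh).
by rewrite (geodesic_mink hg zg) eqxx.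
Qed.

(** By [time_add_timelike], u + v and u + w are in the same time cone, so that v
    and w lie on the same side of u. *)
Lemma not_separates_of_mink u v w g h k :
  represents u (Defs.support g) -> represents v (Defs.support h) ->
  represents w (Defs.support k) ->
  mink u v < -1 -> mink u w < -1 -> mink v w < -1 -> ~ separates g h k.
Proof.
move=> hg hh hk huv huw hvw hsep.
have [z zh zd] := geodesic_point hh; have [x xk xd] := geodesic_point hk.
apply: (hsep z x zh xk); apply: (same_side_connected hg) => //.
have [hu _ _] := hg; have [hv _ _] := hh; have [hw _ _] := hk.
have [sz nz] := mink_lt0_time hu hv huv (hlift_hyperboloid zd) (geodesic_mink hh zh).
have [sx nx] := mink_lt0_time hu hw huw (hlift_hyperboloid xd) (geodesic_mink hk xk).
have ht := time_add_timelike hu hv hw huv huw hvw.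
case: (ltrgt0P (mink u (hlift z))) nz sz => // hz _;
  case: (ltrgt0P (mink u (hlift x))) nx sx => // hx _.
- by move=> _ _; rewrite mulr_gt0.
- by move=> h1 h2; move: ht; rewrite pmulr_lgt0 -?h1// -h2.
- by move=> h1 h2; move: ht; rewrite pmulr_rgt0 -?h2// -h1.
- by move=> _ _; rewrite nmulr_rgt0.
Qed.

(** Here v - w is timelike too, in the time cone of u + v and in the opposite of
    that of u + w, so that v and w lie on different sides of u. *)
Lemma separates_of_mink u v w g h k :
  represents u (Defs.support g) -> represents v (Defs.support h) ->
  represents w (Defs.support k) ->
  mink u v < -1 -> mink u v = mink u w -> 1 < mink v w -> separates g h k.
Proof.
move=> hg hh hk huv huw hvw z x zh xk.
apply: (opposite_sides_separated hg); [exact: zh.2|exact: xk.2|].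
have [hu _ _] := hg; have [hv _ _] := hh; have [hw _ _] := hk.
have huw' : mink u w < -1 by rewrite -huw.
have [sz nz] := mink_lt0_time hu hv huv (hlift_hyperboloid zh.2) (geodesic_mink hh zh).
have [sx nx] := mink_lt0_time hu hw huw' (hlift_hyperboloid xk.2) (geodesic_mink hk xk).
have tvw : mink (vadd v (vopp w)) (vadd v (vopp w)) < 0.
  by rewrite !minkE (minkC w v) hv hw; lra.
have tuv : mink (vadd u v) (vadd u v) < 0.
  by rewrite !minkE (minkC v u) hu hv; lra.
have tuw : mink (vadd u w) (vadd u w) < 0.
  by rewrite !minkE (minkC w u) hu hw -huw; lra.
have h1 : 0 < (time v - time w) * (time u + time v).
  have [<- _] := time_cone tvw tuv.
  by rewrite !minkE hv (minkC v u) (minkC w u) (minkC w v) -huw; lra.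
have twv : mink (vadd w (vopp v)) (vadd w (vopp v)) < 0.
  by rewrite !minkE (minkC w v) hv hw; lra.
have h2 : 0 < (time w - time v) * (time u + time w).
  have [<- _] := time_cone twv tuw.
  by rewrite !minkE hw (minkC v u) (minkC w u) -huw; lra.
have {}h2 : (time v - time w) * (time u + time w) < 0.
  by rewrite -oppr_gt0 -mulNr opprB.
case: (ltrgt0P (mink u (hlift z))) nz sz => // hz _;
  case: (ltrgt0P (mink u (hlift x))) nx sx => // hx _ /esym h3 /esym h4.
- exfalso; move/negbT: h3; move/negbT: h4; rewrite -!leNgt => h4 h3.
  have h5 : time v - time w < 0 by
    rewrite ltNge; apply: contraTN h1 => ?; rewrite -leNgt mulr_ge0_le0.
  by move: h2; rewrite nmulr_rlt0// ltNge h3.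
- by rewrite pmulr_rlt0.
- by rewrite nmulr_rlt0.
- by move: h1; rewrite pmulr_lgt0// => h1; move: h2; rewrite pmulr_rlt0// ltNge ltW.
Qed.

Lemma represents_sign v (s : R) g h w :
  represents v (Defs.support g) -> represents w (Defs.support h) ->
  `|mink v w| = s ->
  exists2 w', represents w' (Defs.support h) & mink v w' = - s.
Proof.
move=> hg hh <-; case: (ltrP (mink v w) 0) => hvw.
  by exists w => //; rewrite ltr0_norm ?opprK.
by exists (vopp w); [exact: represents_opp|rewrite minkNr ger0_norm].
Qed.

(** The distances give the products up to sign. The signs of v1 and v2 can be
    chosen to make the first two products negative; the third is then negative
    because otherwise g0 would separate g1 from g2. *)
Lemma isosceles_vectors (a b : R) g0 g1 g2 : 0 < a -> 0 < b ->
  non_nested g0 g1 g2 -> has_distances b a a g0 g1 g2 ->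
  exists v0 v1 v2,
    [/\ represents v0 (Defs.support g0), represents v1 (Defs.support g1) &
        represents v2 (Defs.support g2)] /\
    [/\ mink v0 v1 = - cosh a, mink v0 v2 = - cosh a & mink v1 v2 = - cosh b].
Proof.
move=> a0 b0 [_ [nsep _ _]] [d12 d20 d01].
have [v0 r0] := geodesic_represented g0.
have [u1 s1] := geodesic_represented g1; have [u2 s2] := geodesic_represented g2.
have [v1 r1 h1] := represents_sign r0 s1 ((geodesic_distP r0 s1 a0).1 d01).
move/(geodesic_distP s2 r0 a0) : d20; rewrite minkC => d02.
have [v2 r2 h2] := represents_sign r0 s2 d02.
exists v0, v1, v2; split=> //; split=> //.
move/(geodesic_distP r1 r2 b0) : d12.
case: (ltrP (mink v1 v2) 0) => h12; first by rewrite ltr0_norm// => <-; rewrite opprK.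
rewrite ger0_norm// => h3; exfalso; apply: nsep.
have ha := cosh_gt1 a0; have hb := cosh_gt1 b0.
apply: (separates_of_mink r0 r1 r2); rewrite ?h1 ?h2 ?h3//; lra.
Qed.

Lemma non_nested_of_mink u v w g h k :
  represents u (Defs.support g) -> represents v (Defs.support h) ->
  represents w (Defs.support k) ->
  mink u v < -1 -> mink u w < -1 -> mink v w < -1 -> non_nested g h k.
Proof.
move=> hg hh hk huv huw hvw.
have hwu : mink w u < -1 by rewrite minkC.
have hvu : mink v u < -1 by rewrite minkC.
have hwv : mink w v < -1 by rewrite minkC.
split; split.
- exact: disjoint_of_mink hg hh _.
- exact: disjoint_of_mink hh hk _.
- exact: disjoint_of_mink hk hg _.
- exact: not_separates_of_mink hg hh hk _ _ _.
- exact: not_separates_of_mink hh hk hg _ _ _.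
- exact: not_separates_of_mink hk hg hh _ _ _.
Qed.

End Triples.

(** * Comparison of limit sets *)

Section LimitSets.
Variable R : realType.
Local Notation vec := (vec R).
Implicit Types (u v w X Z : vec) (g h k : geodesic R) (z p : R[i]).
Implicit Types (S : set (R[i] -> R[i])) (A B : set R[i]).

(** The orbit under words in S alone, which gives an induction principle free of
    inverses when S consists of involutions. *)
Inductive orbit S p : set R[i] :=
  | orbit_base : orbit S p p
  | orbit_step f z : S f -> orbit S p z -> orbit S p (f z).

Lemma generated_group_orbit S p : (forall f, S f -> cancel f f) ->
  [set f p | f in generated_group S] = orbit S p.
Proof.
move=> Sinv; apply/seteqP; split=> z.
  move=> [f Gf <-]; suff H x : orbit S p x <-> orbit S p (f x).
    by apply: (H p).1; exact: orbit_base.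
  elim: Gf x => {f z} [f Sf|//|f g _ IHf _ IHg|f g _ IHf fg gf] x.
  - split=> [|h]; first exact: orbit_step.
    by rewrite -(Sinv _ Sf x); exact: orbit_step.
  - exact: iff_trans (IHg x) (IHf (g x)).
  - by have := IHf (g x); rewrite gf => h; exact: iff_sym.
elim=> [|f x Sf _ [g Gg <-]]; first by exists id => //; exact: generated_id.
by exists (f \o g) => //; apply: generated_comp => //; exact: generated_mem.
Qed.

(** If A accumulates at a point x of the unit circle, then 1 - |z|^2 tends to 0
    along A, hence so does the distance from z to its partner w in B. *)
Lemma limit_points_sub A B (K : R) : 0 <= K ->
  (forall z, A z -> exists2 w, B w & sqn (z - w) <= K * (1 - sqn z)) ->
  closure A `&` @unit_circle R `<=` closure B `&` @unit_circle R.
Proof.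
move=> K0 H x [Ax x1]; split=> // V /nbhs_ballP [e e0 eV].
have {}e0 : 0 < e := e0.
have [he r0] : 0 = Im e /\ 0 < Re e by move: e0; rewrite ltcE /= => /andP[/eqP].
have {}he : e = (Re e)%:C%C by move: he; case: (e) => ? ? /= <-.
set r := Re e in r0 he.
(* The bound on d makes K (1 - |z|^2) <= 2 K d < (r / 2)^2; K + 1 replaces K
   because K may be 0. *)
pose L := K + 1; have L0 : 0 < L by rewrite ltr_wpDl.
pose d := Num.min (r / 2) (r ^+ 2 / (8 * L)).
have d0 : 0 < d by rewrite lt_min !divr_gt0 ?mulr_gt0 ?exprn_gt0.
have [z [Az]] := Ax _ (near_normc x d0); rewrite /= => xz.
have [w Bw hw] := H z Az; exists w; split=> //.
apply: eV; rewrite -ball_normE /= he normE ltcR.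
have -> : x - w = (x - z) + (z - w) by ring.
apply: le_lt_trans (le_normcD _ _) _; rewrite (splitr r).
have xz' : normc (x - z) < r / 2 by apply: lt_le_trans xz _; rewrite ge_min lexx.
rewrite ltrD// -(ltr_pXn2r (n := 2)) ?nnegrE ?normc_ge0 ?divr_ge0 ?(ltW r0)//.
rewrite normc_sqr; apply: (le_lt_trans hw).
have hz : 1 - d < normc z.
  have : normc x <= normc (x - z) + normc z.
    by rewrite -{1}(subrK z x) le_normcD.
  by rewrite x1; lra.
have hz2 : 1 - sqn z < 2 * d.
  rewrite -normc_sqr; have := normc_ge0 z; move: hz; move: (normc z) => n hn n0.
  have : 0 <= (n - 1) ^+ 2 by exact: sqr_ge0.
  rewrite sqrrB1 mulr2n; lra.
have d2 : d <= r ^+ 2 / (8 * L) by rewrite ge_min lexx orbT.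
have hd : L * d <= r ^+ 2 / 8.
  move: d2; rewrite -(ler_pM2l L0); congr (_ <= _).
  by field; rewrite gt_eqF.
apply: (@le_lt_trans _ _ (K * (2 * d))); first by rewrite ler_wpM2l// ltW.
apply: (@lt_le_trans _ _ (L * (2 * d))).
  by rewrite ltr_pM2r ?mulr_gt0// /L ltrDl.
have -> : L * (2 * d) = 2 * (L * d) by ring.
rewrite [leRHS](_ : _ = 2 * (r ^+ 2 / 8)); last by field.
by rewrite ler_pM2l.
Qed.

Lemma mink_reflection u g z (w : R[i]) : represents u (Defs.support g) ->
  unit_disk z -> unit_disk w ->
  mink (hlift (geodesic_reflection g z)) (hlift (geodesic_reflection g w)) =
  mink (hlift z) (hlift w).
Proof.
move=> [hu _ hr] hz hw; rewrite /geodesic_reflection.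
by rewrite (hr _ hz).2 (hr _ hw).2 mink_lref.
Qed.

Lemma geodesic_reflectionK g : cancel (geodesic_reflection g) (geodesic_reflection g).
Proof. by apply: reflectionK; exact: support_nondegenerate. Qed.

Lemma geodesic_reflection_disk u g z : represents u (Defs.support g) ->
  unit_disk z -> unit_disk (geodesic_reflection g z).
Proof. by move=> [_ _ hr] /hr[]. Qed.

Lemma geodesic_reflection_conj u v g h k z :
  represents u (Defs.support g) -> represents v (Defs.support h) ->
  represents (lref u v) (Defs.support k) -> unit_disk z ->
  geodesic_reflection k z =
  geodesic_reflection g (geodesic_reflection h (geodesic_reflection g z)).
Proof.
move=> hg hh hk hz; have hz1 := geodesic_reflection_disk hg hz.
have hz2 := geodesic_reflection_disk hh hz1.
have hz3 := geodesic_reflection_disk hg hz2.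
have hz4 := geodesic_reflection_disk hk hz.
rewrite -(hliftK hz4) -(hliftK hz3); congr hproj.
have [hu _ rg] := hg; have [_ _ rh] := hh; have [_ _ rk] := hk.
rewrite /geodesic_reflection in hz1 hz2 *.
by rewrite (rk _ hz).2 (rg _ hz2).2 (rh _ hz1).2 (rg _ hz).2 lref_conj.
Qed.

(** The hypotheses say that the reflections r0 and rm commute, that r2 is
    rm r1 rm and that rw is r0 r1 r0. Conjugation by r0 permutes the generators
    rm, r1, rw of the second group, so the union of its orbits of 0 and of r0(0)
    is stable under r0, r1 and r2. The statement applied with g0 and gm, and
    also g2 and gw, exchanged gives the other inclusion. *)
Lemma limit_set_sub v0 v1 m g0 g1 g2 gm gw :
  represents v0 (Defs.support g0) -> represents v1 (Defs.support g1) ->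
  represents (lref m v1) (Defs.support g2) -> represents m (Defs.support gm) ->
  represents (lref v0 v1) (Defs.support gw) -> mink v0 m = 0 ->
  limit_set (reflection_group g0 g1 g2) `<=`
  limit_set (reflection_group gm g1 gw).
Proof.
move=> h0 h1 h2 hm hw v0m; rewrite /limit_set /reflection_group.
rewrite !generated_group_orbit; try by
  move=> f [[]|] ->; exact: geodesic_reflectionK.
set S1 := [set _; _; _]; set S2 := [set _; _; _].
set r0 := geodesic_reflection g0; set rm := geodesic_reflection gm.
set r1 := geodesic_reflection g1; set r2 := geodesic_reflection g2.
set rw := geodesic_reflection gw.
have r0K : cancel r0 r0 := @geodesic_reflectionK g0.
have rmK : cancel rm rm := @geodesic_reflectionK gm.
have r2E z : unit_disk z -> r2 z = rm (r1 (rm z)).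
  exact: geodesic_reflection_conj hm h1 h2.
have rwE z : unit_disk z -> rw z = r0 (r1 (r0 z)).
  exact: geodesic_reflection_conj h0 h1 hw.
have d0 z : unit_disk z -> unit_disk (r0 z) by exact: geodesic_reflection_disk h0.
have d1 z : unit_disk z -> unit_disk (r1 z) by exact: geodesic_reflection_disk h1.
have dm z : unit_disk z -> unit_disk (rm z) by exact: geodesic_reflection_disk hm.
have dw z : unit_disk z -> unit_disk (rw z) by exact: geodesic_reflection_disk hw.
have r0m z : unit_disk z -> r0 (rm z) = rm (r0 z).
  move=> hz; have hk : represents (lref v0 m) (Defs.support gm).
    by rewrite /lref v0m (_ : vadd _ _ = m)//; apply: vec_eqP => /=; ring.
  rewrite {2}/rm (geodesic_reflection_conj h0 hm hk (d0 _ hz)) -/rm -/r0.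
  by rewrite r0K.
have S2m : S2 rm by left; left.
have S21 : S2 r1 by left; right.
have S2w : S2 rw by right.
have disk2 p z : unit_disk p -> orbit S2 p z -> unit_disk z.
  move=> hp; elim=> // f x [[]|] -> _ hx; [exact: dm|exact: d1|exact: dw].
have swap p z : unit_disk p -> orbit S2 p z -> orbit S2 (r0 p) (r0 z).
  move=> hp; elim=> [|f x Sf ox IH]; first exact: orbit_base.
  have hx := disk2 _ _ hp ox.
  case: Sf => [[]|] ->; rewrite -/rm -/r1 -/rw.
  - by rewrite r0m//; exact: orbit_step.
  - have -> : r0 (r1 x) = rw (r0 x) by rewrite rwE ?r0K//; exact: d0.
    exact: orbit_step.
  - by rewrite rwE// r0K; exact: orbit_step.
have z0 : unit_disk (0 : R[i]) by apply/unit_diskE; rewrite /sqn /= expr0n addr0.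
have cover z : orbit S1 0 z -> orbit S2 0 z \/ orbit S2 (r0 0) z.
  elim=> [|f x Sf _ IH]; first by left; exact: orbit_base.
  have hx : unit_disk x by case: IH; apply: disk2 => //; exact: d0.
  case: Sf => [[]|] ->; rewrite -/r0 -/r1 -/r2.
  - case: IH => h; [right|left]; last rewrite -(r0K 0); apply: swap => //.
    exact: d0.
  - by case: IH => h; [left|right]; exact: orbit_step.
  - by rewrite r2E//; case: IH => h; [left|right]; do 3!apply: orbit_step => //.
pose C := - mink (hlift 0) (hlift (r0 0)).
have K0 : 0 <= (C - 1) / 2.
  rewrite /C mink_hlift//; last exact: d0.
  have /unit_diskE q1 := z0; have /unit_diskE q2 := d0 _ z0.
  by rewrite [1 + _]addrC addrK divr_ge0// divr_ge0 ?mulr_ge0 ?sqn_ge0 ?subr_ge0 ?ltW.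
apply: (limit_points_sub K0) => z /cover [oz|oz].
  have /unit_diskE q := disk2 _ _ z0 oz.
  exists z => //; rewrite subrr {1}/sqn /= expr0n addr0.
  by rewrite mulr_ge0// subr_ge0 ltW.
(* An element of the second group moves the pair (0, r0(0)) to a pair at the
   same hyperbolic distance. *)
have [w ow zwC] : exists2 w, orbit S2 0 w & - mink (hlift z) (hlift w) = C.
  elim: oz => [|f x Sf ox [w ow <-]].
    by exists 0; [exact: orbit_base|rewrite minkC].
  exists (f w); first exact: orbit_step.
  have hx := disk2 _ _ (d0 _ z0) ox; have hw' := disk2 _ _ z0 ow.
  congr (- _); case: Sf => [[]|] ->.
  - exact: mink_reflection hm hx hw'.
  - exact: mink_reflection h1 hx hw'.
  - exact: mink_reflection hw hx hw'.
have hz := disk2 _ _ (d0 _ z0) oz; have hw' := disk2 _ _ z0 ow.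
exists w => //; rewrite sqn_hlift// zwC.
have /unit_diskE q := hz; have /unit_diskE q' := hw'.
rewrite ler_wpM2l// ler_piMr ?subr_ge0 ?(ltW q)//.
by rewrite lerBlDr lerDl sqn_ge0.
Qed.


End LimitSets.

(** * The exchange of the two isosceles triples *)

Section Main.
Variable R : realType.

(** The new triple consists of the symmetry axis of (g0; g1, g2), of g1, and of
    the image of g1 under the reflection in g0. *)
Lemma isosceles_swap (a b : R) (g0 g1 g2 : geodesic R) :
  0 < a -> 0 < b -> non_nested g0 g1 g2 ->
  has_distances (2 * b) a a g0 g1 g2 ->
  exists h0 h1 h2, [/\ non_nested h0 h1 h2,
    has_distances (2 * a) b b h0 h1 h2 &
    limit_set (reflection_group g0 g1 g2) =
    limit_set (reflection_group h0 h1 h2)].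
Proof.
move=> a0 b0 hn hd; have b20 : 0 < 2 * b by rewrite mulr_gt0.
have [v0 [v1 [v2 [[h0 h1 h2] [v01 v02 v12]]]]] := isosceles_vectors a0 b20 hn hd.
have [u0 _ _] := h0; have [u1 _ _] := h1; have [u2 _ _] := h2.
have ca := cosh_gt1 a0; have cb := cosh_gt1 b0.
rewrite cosh_double in v12.
(* The axis of symmetry of the triple; its reflection exchanges v1 and v2. *)
pose m := vscale (2 * cosh b)^-1 (vadd v2 (vopp v1)).
have b2 : 2 * cosh b != 0 by rewrite mulf_neq0 ?gt_eqF//; lra.
have b1 : cosh b != 0 by rewrite gt_eqF//; lra.
have mm : mink m m = 1.
  by rewrite /m !minkE (minkC v2 v1) u1 u2 v12; field.
have mv0 : mink v0 m = 0 by rewrite /m !minkE v01 v02; ring.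
have mv1 : mink m v1 = - cosh b.
  by rewrite /m !minkE (minkC v2 v1) u1 v12; field.
have hv2 : lref m v1 = v2.
  by rewrite /lref mv1 /m; apply: vec_eqP => /=; field.
pose w := lref v0 v1.
have ww : mink w w = 1 by rewrite /w mink_lref.
have mw : mink m w = - cosh b.
  by rewrite /w /lref minkDr minkZr mv1 (minkC m v0) mv0; ring.
have v1w : mink v1 w = - cosh (2 * a).
  by rewrite /w /lref minkDr minkZr u1 (minkC v1 v0) v01 cosh_double; ring.
have [gm hm] := geodesic_exists mm; have [gw hw] := geodesic_exists ww.
exists gm, g1, gw; split.
- have c2a : 1 < cosh (2 * a) by rewrite cosh_gt1 ?mulr_gt0.
  by apply: (non_nested_of_mink hm h1 hw); rewrite ?mv1 ?mw ?v1w ltrN2.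
- split.
  + apply/(geodesic_distP h1 hw); first by rewrite mulr_gt0.
    by rewrite v1w normrN gtr0_norm// (lt_trans ltr01)// cosh_gt1 ?mulr_gt0.
  + apply/(geodesic_distP hw hm b0).
    by rewrite minkC mw normrN gtr0_norm// (lt_trans ltr01).
  + apply/(geodesic_distP hm h1 b0).
    by rewrite mv1 normrN gtr0_norm// (lt_trans ltr01).
- rewrite -hv2 in h2; apply/seteqP; split.
    exact: limit_set_sub h0 h1 h2 hm hw mv0.
  by apply: (limit_set_sub hm h1 hw h0 h2); rewrite minkC.
Qed.

End Main.

Theorem proposition4p2 (R : realType) (a b : R) (ha : 0 < a) (hb : 0 < b) :
  D (2 * b) a a = D (2 * a) b b.
Proof.
suff H (a' b' : R) : 0 < a' -> 0 < b' ->
  [set x | exists g0 g1 g2 : geodesic R,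
    [/\ non_nested g0 g1 g2, has_distances (2 * b') a' a' g0 g1 g2 &
        x = hausdorff_dim (limit_set (reflection_group g0 g1 g2))]] `<=`
  [set x | exists g0 g1 g2 : geodesic R,
    [/\ non_nested g0 g1 g2, has_distances (2 * a') b' b' g0 g1 g2 &
        x = hausdorff_dim (limit_set (reflection_group g0 g1 g2))]].
  by rewrite /D; congr xget; apply/seteqP; split; exact: H.
move=> a0 b0 x [g0 [g1 [g2 [hn hd ->]]]].
have [h0 [h1 [h2 [kn kd ->]]]] := isosceles_swap a0 b0 hn hd.
by exists h0, h1, h2.
Qed.
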